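(* Let $n\ge 1$ be an integer, let $a,c\in\mathbb{C}$ with $c\notin\{0,-1,-2,\dots\}$, and let $x_1,\dots,x_n\in\mathbb{C}$ satisfy $|x_1|+\dots+|x_n|<1/4$. Then $$F\left(\frac a2,\frac{a+1}2;c;4(x_1+\dots+x_n)\right)=\sum_{m_1,\dots,m_n=0}^{\infty}\frac{(a)_{2m_1+\dots+2m_n}\,x_1^{m_1}\cdots x_n^{m_n}}{(c)_{m_1+\dots+m_n}\,m_1!\cdots m_n!}.$$
   Context: $(a)_m=a(a+1)\cdots(a+m-1)$ is the Pochhammer symbol (with $(a)_0=1$; it equals $\Gamma(a+m)/\Gamma(a)$ when defined), and $F(\alpha,\beta;\gamma;z)=\sum_{m=0}^\infty\frac{(\alpha)_m(\beta)_m}{(\gamma)_m\,m!}z^m$ is the Gauss hypergeometric function ($|z|<1$). *)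

(* Defs.v *)
From mathcomp Require Import all_boot all_order all_algebra.
From mathcomp Require Import complex.
From mathcomp Require Import boolp classical_sets reals topology normedtype sequences summability.

Set Implicit Arguments.
Unset Strict Implicit.
Unset Printing Implicit Defensive.

Import Order.TTheory GRing.Theory Num.Theory.
Import numFieldNormedType.Exports.

Local Open Scope classical_set_scope.
Local Open Scope ring_scope.

Definition pochhammer (K : pzSemiRingType) (a : K) (m : nat) : K :=
  \prod_(i < m) (a + i%:R).

Definition hyp2F1_term (K : numFieldType) (alpha beta gamma z : K) : K^nat :=
  fun m => pochhammer alpha m * pochhammer beta m
           / (pochhammer gamma m * m`!%:R) * z ^+ m.

(* [limn] is total: the value is only meaningful when the series converges. *)
Definition hyp2F1 (K : numFieldType) (alpha beta gamma z : K) : K :=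
  limn (series (hyp2F1_term alpha beta gamma z)).

(* A multi-index (m_1, ..., m_n) is m : {ffun 'I_n -> nat}. *)
Definition multi_term (K : numFieldType) (n : nat) (a c : K) (x : 'I_n -> K)
    (m : {ffun 'I_n -> nat}) : K :=
  pochhammer a (\sum_(i < n) 2 * m i)%N * (\prod_(i < n) x i ^+ m i)
  / (pochhammer c (\sum_(i < n) m i)%N * \prod_(i < n) (m i)`!%:R).

(* Main.v *)
Require Import Defs.
From mathcomp Require Import all_boot all_order all_algebra.
From mathcomp Require Import complex finmap ring lra.
From mathcomp Require Import boolp classical_sets reals topology normedtype sequences summability.
Import Order.TTheory GRing.Theory Num.Theory.
Import numFieldNormedType.Exports.
Local Open Scope classical_set_scope.
Local Open Scope ring_scope.
Local Open Scope complex_scope.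

(** Write g k = (a)_(2k) / (c)_k and s = |x_1| + ... + |x_n|.  Both sides of the
identity are sums of the same terms, grouped differently.

On the left, the duplication formula (a)_(2k) = 4^k (a/2)_k ((a+1)/2)_k turns
the k-th hypergeometric term at 4 (x_1 + ... + x_n) into
g k (x_1 + ... + x_n)^k / k!.  By the multinomial theorem this is the total of
the terms of the right-hand side with |m| = m_1 + ... + m_n = k, because
such a term is g |m| times the product of the x_i^(m_i) / m_i!.  So the sum over
the simplex |m| < N is exactly the N-th partial sum of the hypergeometric series
(sum_simplex).

The same computation applied to absolute values shows that the sum of the norms
over the simplex is the N-th partial sum of the real series
|g k| s^k / k!.  Each of its terms is the preceding one times a factor that
tends to 4 s < 1, hence it converges (cvg_series_poch_ratio), and with it the
hypergeometric series.

It remains to pass from summation along simplices to unordered summation.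
The simplices exhaust all multi-indices, so absolute convergence along them
forces every larger finite set to have nearly the same sum as a large simplex
(cvg_totally_exhaustion). *)

(** * Duplication formula for Pochhammer symbols *)

Lemma pochhammerS (K : pzSemiRingType) (a : K) (m : nat) :
  pochhammer a m.+1 = pochhammer a m * (a + m%:R).
Proof. by rewrite /pochhammer big_ord_recr. Qed.

(** The 2m factors of (a)_(2m) pair up as
(a + 2k)(a + 2k + 1) = 4 (a/2 + k)((a + 1)/2 + k). *)
Lemma pochhammer_double (K : numFieldType) (a : K) (m : nat) :
  pochhammer a (2 * m) =
  4 ^+ m * (pochhammer (a / 2) m * pochhammer ((a + 1) / 2) m).
Proof.
elim: m => [|m IH]; first by rewrite muln0 expr0 /pochhammer !big_ord0 !mulr1.
rewrite mulnS !pochhammerS IH exprS -natr1 natrM.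
by field.
Qed.

(** * Multinomial theorem over a simplex of multi-indices *)

(** The multinomial theorem in generating-function form: below degree N, the
truncated exponentials multiply like exp (y_i X), so that their product agrees
with exp ((sum of the y_i) X).  One factor at a time, this is the binomial
theorem. *)
Lemma coef_prod_trunc_exp {K : numFieldType} {I : Type} (s : seq I) (y : I -> K)
    {N k : nat} : (k < N)%N ->
  (\prod_(i <- s) \poly_(j < N) (y i ^+ j / j`!%:R))`_k
  = (\sum_(i <- s) y i) ^+ k / k`!%:R.
Proof.
elim: s k => [|i s IH] k kN.
  rewrite !big_nil coef1 expr0n.
  by case: k kN => [|k] _ /=; rewrite ?mul0r // fact0 invr1 mulr1.
rewrite !big_cons addrC exprDn coefM mulr_suml.
apply: eq_bigr => j _.
have jk : (j <= k)%N by rewrite -ltnS.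
have fact_neq0 m : m`!%:R != 0 :> K by rewrite pnatr_eq0 -lt0n fact_gt0.
rewrite coef_poly (leq_ltn_trans jk kN) IH ?(leq_ltn_trans (leq_subr _ _) kN) //.
rewrite -(bin_fact jk) -mulr_natr !natrM.
by field; rewrite !fact_neq0 pnatr_eq0 -lt0n bin_gt0.
Qed.

(** Multi-indices with entries below N form a finite type, over which products of
sums can be expanded; this map embeds them among all multi-indices. *)
Definition multi_of_ord {n N : nat} (f : {ffun 'I_n -> 'I_N}) :
  {ffun 'I_n -> nat} := [ffun i => val (f i)].

(** A total degree below N bounds every entry by N, so the simplex of such
multi-indices is cut out of the finite box of side N. *)
Definition simplex (n N : nat) : {fset {ffun 'I_n -> nat}} :=
  [fset multi_of_ord f | f in [pred f : {ffun 'I_n -> 'I_N} |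
     (\sum_(i < n) f i < N)%N]]%fset.

Lemma in_simplex (n N : nat) (m : {ffun 'I_n -> nat}) :
  (m \in simplex n N) = (\sum_(i < n) m i < N)%N.
Proof.
apply/imfsetP/idP => [[f /= fN ->]|mN].
  by under eq_bigr do rewrite ffunE.
have miN i : (m i < N)%N by rewrite (leq_ltn_trans _ mN) // (bigD1 i) //= leq_addr.
exists [ffun i => Ordinal (miN i)]; last by apply/ffunP => i; rewrite !ffunE.
by rewrite /in_mem /=; under eq_bigr do rewrite ffunE.
Qed.

Lemma big_simplex (K : zmodType) (n N : nat) (G : {ffun 'I_n -> nat} -> K) :
  \sum_(m <- simplex n N) G m =
  \sum_(f : {ffun 'I_n -> 'I_N} | (\sum_(i < n) f i < N)%N) G (multi_of_ord f).
Proof.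
rewrite big_imfset /=; first by rewrite big_enum.
move=> f g _ _ /ffunP fg; apply/ffunP => i; apply/val_inj.
by have := fg i; rewrite !ffunE.
Qed.

(** Grouping the multi-indices by total degree k, the weight g k factors out and
the multinomial theorem sums the rest. *)
Lemma sum_simplex {K : numFieldType} {n N : nat} (g : nat -> K) (y : 'I_n -> K) :
  \sum_(m <- simplex n N)
     g (\sum_(i < n) m i)%N * \prod_(i < n) (y i ^+ m i / (m i)`!%:R)
  = \sum_(k < N) g k * ((\sum_(i < n) y i) ^+ k / k`!%:R).
Proof.
rewrite big_simplex.
(* Each index f of total degree k < N is charged to that one k. *)
transitivity (\sum_(k < N) \sum_(f : {ffun 'I_n -> 'I_N})
    (g k * \prod_(i < n) (y i ^+ f i / (f i)`!%:R)) *+ (k == (\sum_i f i)%N :> nat)).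
  rewrite exchange_big /= big_mkcond /=; apply: eq_bigr => f _.
  case: ifPn => [fN|]; last first.
    rewrite -leqNgt => Nf; rewrite big1 // => k _.
    by rewrite ltn_eqF // (leq_trans (ltn_ord k)).
  rewrite (bigD1 (Ordinal fN)) //= eqxx mulr1n [X in _ + X]big1 ?addr0 => [|k kf].
  congr (g _ * _); first by apply: eq_bigr => i _; rewrite ffunE.
    by apply: eq_bigr => i _; rewrite ffunE.
  by rewrite -[(\sum_i _)%N]/(val (Ordinal fN)) val_eqE (negbTE kf).
apply: eq_bigr => k _.
(* Expanding the product of truncated exponentials, the coefficient of X^k
   collects the indices f of total degree k. *)
rewrite -(coef_prod_trunc_exp _ _ (ltn_ord k)).
under [X in _ = _ * (polyseq X)`_ _]eq_bigr do rewrite poly_def.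
rewrite bigA_distr_bigA /= coef_sum mulr_sumr; apply: eq_bigr => f _.
by rewrite [in RHS]scaler_prod prodrXr coefZ coefXn -mulrnAr mulr_natr.
Qed.

(** * Unordered summation along an exhaustion *)

Lemma big_fset_sub {K : zmodType} {I : choiceType} {X Y : {fset I}} (F : I -> K) :
  (X `<=` Y)%fset ->
  \sum_(i <- Y) F i = \sum_(i <- X) F i + \sum_(i <- (Y `\` X)%fset) F i.
Proof.
move=> /fsubsetP XY; rewrite (big_fsetID _ (mem X)) /=; congr (_ + _).
  apply: eq_fbigl => i; rewrite !inE /=.
  by apply/andP/idP => [[]//|iX]; split => //; apply: XY.
by apply: eq_fbigl => i; rewrite !inE /= andbC.
Qed.

Lemma partial_sumE {K : zmodType} {I : choiceType} (t : I -> K) (B : {fset I}) :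
  partial_sum t B = \sum_(i <- B) t i.
Proof. by rewrite big_seq_fsetE. Qed.

(** Once A N is large, any finite B containing it lies in some A M, and its
extra terms B \ A N have norms adding up to at most the increment of the
absolute sums from A N to A M, which is small by convergence. *)
Lemma cvg_totally_exhaustion {K : numFieldType} {I : choiceType} (t : I -> K)
    (A : nat -> {fset I}) (L : K) :
  (forall N M, (N <= M)%N -> (A N `<=` A M)%fset) ->
  (forall B : {fset I}, exists M, (B `<=` A M)%fset) ->
  cvgn (fun N => \sum_(i <- A N) `|t i| : K) ->
  (fun N => \sum_(i <- A N) t i) @ \oo --> L ->
  partial_sum t @ totally --> L.
Proof.
move=> A_mono A_exh V_cvg /cvgrPdist_lt S_cvg.
have := @totally_filter I => totally_proper.
apply/cvgrPdist_lt => e e0.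
have e3 : 0 < e / 3%:R by rewrite divr_gt0.
have /cvgrPdist_lt/(_ _ e3)[N1 _ V_near] := V_cvg.
have [N2 _ S_near] := S_cvg _ e3.
pose N := maxn N1 N2.
exists (A N) => //= B /= AB; rewrite partial_sumE.
have [M0 BM0] := A_exh B; pose M := maxn M0 N.
have BM : (B `<=` A M)%fset by rewrite (fsubset_trans BM0) // A_mono // leq_maxl.
have tail : `|\sum_(i <- (B `\` A N)%fset) t i|
    <= \sum_(i <- A M) `|t i| - \sum_(i <- A N) `|t i|.
  rewrite (big_fset_sub _ (fsubset_trans AB BM)) addrC addKr.
  rewrite (le_trans (ler_norm_sum _ _ _)) //.
  by rewrite (big_fset_sub _ (fsetSD (A N) BM)) lerDl sumr_ge0.
rewrite (big_fset_sub _ AB) opprD addrA.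
rewrite (le_lt_trans (ler_normB _ _)) //.
have -> : e = e / 3%:R + (e / 3%:R + e / 3%:R) by field.
apply: ltrD; first by apply: S_near; rewrite /= leq_maxr.
apply: le_lt_trans tail _.
have /V_near VN : (N1 <= N)%N by rewrite leq_maxl.
have /V_near VM : (N1 <= M)%N by rewrite (leq_trans (leq_maxl N1 N2)) // leq_maxr.
have d_ge0 : 0 <= \sum_(i <- A M) `|t i| - \sum_(i <- A N) `|t i|.
  rewrite (big_fset_sub _ (fsubset_trans AB BM)) addrC addKr.
  by rewrite sumr_ge0.
rewrite -(ger0_norm d_ge0).
rewrite distrC in VM.
rewrite (le_lt_trans _ (ltrD VM VN)) //.
by rewrite (le_trans _ (ler_normD _ _)) // addrA addrNK.
Qed.

(** * Ratio test *)

Lemma geometric_majorant {R : realFieldType} {v : nat -> R} {q : R} {N : nat} :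
  0 < q -> (forall k, 0 <= v k) ->
  (forall k, (N <= k)%N -> v k.+1 <= q * v k) ->
  exists2 C, 0 <= C & forall k, v k <= C * q ^+ k.
Proof.
move=> q0; elim: N v => [|N IH] v v0 vq.
  exists (v 0%N) => //; elim=> [|k IH]; first by rewrite expr0 mulr1.
  by rewrite (le_trans (vq _ _)) // exprS mulrCA ler_pM2l.
have [|k Nk|C C0 vC] := IH (fun k => v k.+1); [by []|by apply: vq|].
(* Shifting the majorant of the tail by one index costs a factor 1 / q; the
   summand v 0 takes care of the first term. *)
exists (v 0%N + C / q) => [|[|k]]; first by rewrite addr_ge0 // divr_ge0 // ltW.
  by rewrite expr0 mulr1 lerDl divr_ge0 // ltW.
rewrite (le_trans (vC k)) // exprS mulrA mulrDl divfK ?gt_eqF //.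
by rewrite ler_pM2r ?exprn_gt0 // lerDr mulr_ge0 // ltW.
Qed.

Lemma ratio_test {R : realType} {v : nat -> R} {q : R} {N : nat} :
  0 < q < 1 -> (forall k, 0 <= v k) ->
  (forall k, (N <= k)%N -> v k.+1 <= q * v k) -> cvgn (series v).
Proof.
move=> /andP[q0 q1] v0 vq; have [C C0 vC] := geometric_majorant q0 v0 vq.
apply: (@series_le_cvg _ v (geometric C q)) => //.
  by move=> k; rewrite /= mulr_ge0 // exprn_ge0 // ltW.
by apply: is_cvg_geometric_series; rewrite ger0_norm // ltW.
Qed.

(** * Series of complex numbers *)

(** A positive complex number is real, so the radii in the topology of R[i]
may be taken in R. *)
Lemma cvg_complexP {R : realType} {T : Type} {F : set_system T} {FF : Filter F}
    (f : T -> (R[i] : numFieldType)) (l : (R[i] : numFieldType)) :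
  (forall e : R, 0 < e -> \forall x \near F, `|l - f x| < e%:C) ->
  f x @[x --> F] --> l.
Proof.
move=> fl; apply/cvgrPdist_lt => e e0.
have /complex_realP[r er] : e \is Num.real by exact: gtr0_real.
by move: e0; rewrite er ltcR; apply: fl.
Qed.

Lemma le_complex_norm_ReIm {R : realType} (z : R[i]) :
  `|z| <= (`|complex.Re z| + `|complex.Im z|)%:C.
Proof.
case: z => a b /=; rewrite normc_def /= lecR.
rewrite -(@ler_pXn2r _ 2) ?nnegrE ?sqrtr_ge0 ?addr_ge0 //.
rewrite sqr_sqrtr ?addr_ge0 ?sqr_ge0 // sqrrD !real_normK ?num_real //.
by rewrite lerD2r lerDl mulrn_wge0 // mulr_ge0.
Qed.

Lemma complex_norm_ge_Im {R : realType} (z : R[i]) :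
  `|complex.Im z|%:C <= `|z|.
Proof.
case: z => a b; rewrite normc_def lecR /= -sqrtr_sqr.
by rewrite ler_wsqrtr // lerDr sqr_ge0.
Qed.

(** The comparison test reduces to that in R, because both the real and the
imaginary parts are dominated by v; their two sums are the parts of the
limit. *)
Lemma cvg_series_complex {R : realType} {u : (R[i] : numFieldType)^nat}
    (v : R^nat) :
  (forall k, `|u k| <= (v k)%:C) -> cvgn (series v) -> cvgn (series u).
Proof.
move=> uv v_cvg.
have v0 k : 0 <= v k by rewrite -ler0c (le_trans _ (uv k)).
have dom (w : R^nat) : (forall k, `|w k|%:C <= `|u k|) -> cvgn (series w).
  move=> wu; apply: (@normed_cvg _ R^o).
  apply: (@series_le_cvg _ _ v) => // k /=; first exact: normr_ge0.
  by rewrite -lecR; exact: le_trans (wu k) (uv k).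
have /cvg_ex[a /cvgrPdist_lt re] : cvgn (series (fun k => complex.Re (u k))).
  by apply: dom => k; exact: normc_ge_Re.
have /cvg_ex[b /cvgrPdist_lt im] : cvgn (series (fun k => complex.Im (u k))).
  by apply: dom => k; exact: complex_norm_ge_Im.
apply/cvg_ex; exists (a +i* b); apply: cvg_complexP => e e0.
have e2 : 0 < e / 2 by rewrite divr_gt0.
near=> n.
apply: le_lt_trans (le_complex_norm_ReIm _) _; rewrite ltcR.
rewrite [e]splitr; apply: ltrD.
  rewrite raddfB /= /series /= raddf_sum.
  by near: n; apply: re.
rewrite raddfB /= /series /= raddf_sum.
by near: n; apply: im.
Unshelve. all: by end_near. Qed.

(** * Hypergeometric and multiple series *)

Definition poch_ratio {K : numFieldType} (a c : K) (k : nat) : K :=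
  pochhammer a (2 * k) / pochhammer c k.

Lemma hyp2F1_term_double {K : numFieldType} (a c z : K) (k : nat) :
  hyp2F1_term (a / 2) ((a + 1) / 2) c (4 * z) k
  = poch_ratio a c k * (z ^+ k / k`!%:R).
Proof.
rewrite /hyp2F1_term /poch_ratio pochhammer_double exprMn invfM.
set p := pochhammer _ _; set q := pochhammer _ _; set r := pochhammer _ _.
by rewrite -!mulrA; ring.
Qed.

Lemma multi_termE {K : numFieldType} {n : nat} (a c : K) (x : 'I_n -> K)
    (m : {ffun 'I_n -> nat}) :
  multi_term a c x m = poch_ratio a c (\sum_(i < n) m i)%N *
    \prod_(i < n) (x i ^+ m i / (m i)`!%:R).
Proof.
rewrite /multi_term /poch_ratio -big_distrr /= big_split /= prodfV invfM.
by rewrite -!mulrA; congr (_ * _); rewrite mulrCA.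
Qed.

Lemma normr_exp_fact {K : numFieldType} (z : K) (k : nat) :
  `|z ^+ k / k`!%:R| = `|z| ^+ k / k`!%:R.
Proof. by rewrite normrM normrX normfV normr_nat. Qed.

(** The ratio of consecutive terms of |g k| s^k / k! is bounded, with A = |a| and
C = |c|, by (A + 2k)(A + 2k + 1) s / ((k - C)(k + 1)), which tends to 4 s.  Any
q strictly between 4 s and 1 therefore works eventually; the midpoint of
4 s and 1 is taken.  The condition C < k keeps c + k away from 0. *)
Lemma eventual_ratio {R : realType} {A C s : R} :
  0 <= A -> 0 <= C -> 0 <= s -> s < 1 / 4 ->
  exists q : R, exists2 N : nat, 0 < q < 1 &
    forall k, (N <= k)%N -> C < k%:R /\
      (A + (2 * k)%:R) * (A + (2 * k)%:R + 1) * s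
      <= q * ((k%:R - C) * k.+1%:R).
Proof.
move=> A0 C0 s0 s4; pose q := (1 + 4 * s) / 2; pose d := q - 4 * s.
have d0 : 0 < d by rewrite /d /q; lra.
(* X is chosen so that the quadratic term d x^2, which is the gap between
   q x^2 and 4 s x^2, dominates all lower-order terms for x > X. *)
pose X := ((A + 1) * (A + 4) + 2 * C) / d + C + 1.
have Y0 : 0 <= ((A + 1) * (A + 4) + 2 * C) / d.
  by rewrite divr_ge0 ?ltW //; nra.
have X0 : 0 <= X by rewrite /X; lra.
exists q; exists (Num.bound X); first by rewrite /q; apply/andP; split; lra.
move=> k Xk.
have kX : X < k%:R.
  by rewrite (lt_le_trans (archi_boundP X0)) // ler_nat.
rewrite natrM -natr1; set x := k%:R in kX *.
have Cx : C < x by rewrite /X in kX; lra.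
have x1 : 1 < x by rewrite /X in kX; lra.
split=> //.
have dx : (A + 1) * (A + 4) + 2 * C <= d * x.
  rewrite [d * x]mulrC -ler_pdivrMr //; rewrite /X in kX; lra.
have q1 : q < 1 by rewrite /q; lra.
have q0 : 0 <= q by rewrite /q; lra.
have x0 : 0 <= x by lra.
have h1 : 0 <= q * x by rewrite mulr_ge0.
have h2 : q * (C * x) <= C * x by rewrite ler_piMl ?mulr_ge0 // ltW.
have h3 : q * C <= C * x by rewrite mulrC ler_wpM2l //; lra.
have h4 : s * ((4 * A + 2) * x) <= 1 / 4 * ((4 * A + 2) * x).
  by rewrite ler_wpM2r ?mulr_ge0 //; lra.
have h5 : s * (A * (A + 1)) <= x * (A * (A + 1)).
  by rewrite ler_wpM2r ?mulr_ge0 //; lra.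
have h6 : ((A + 1) * (A + 4) + 2 * C) * x <= d * x * x by rewrite ler_wpM2r.
have h7 : 0 <= A * x by rewrite mulr_ge0.
rewrite /d in h6; lra.
Qed.

(** The terms are nonnegative complex numbers, hence images of reals v k; the
ratio test applies to v. *)
Lemma cvg_series_poch_ratio {R : realType} (a c : R[i]) {s : R[i]} :
  0 <= s -> s < 1 / 4 ->
  exists2 v : R^nat, cvgn (series v) &
    forall k, `|poch_ratio a c k| * (s ^+ k / k`!%:R) = (v k)%:C.
Proof.
move=> s0 s4.
pose U k := `|poch_ratio a c k| * (s ^+ k / k`!%:R).
have U0 k : 0 <= U k by rewrite mulr_ge0 ?divr_ge0 ?exprn_ge0.
pose v k := complex.Re (U k).
have Uv k : U k = (v k)%:C by rewrite RRe_real // ger0_real.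
exists v => //.
have [A Aa] : exists A : R, `|a| = A%:C by apply/complex_realP; exact: normr_real.
have [C Cc] : exists C : R, `|c| = C%:C by apply/complex_realP; exact: normr_real.
have [t st] : exists t : R, s = t%:C by apply/complex_realP; exact: ger0_real.
have A0 : 0 <= A by rewrite -ler0c -Aa.
have C0 : 0 <= C by rewrite -ler0c -Cc.
have t0 : 0 <= t by rewrite -ler0c -st.
have t4 : t < 1 / 4.
  by rewrite -ltcR -st (lt_le_trans s4) // rmorphM fmorphV /= rmorph1 rmorph_nat.
have [q [N q01 ratio]] := eventual_ratio A0 C0 t0 t4.
apply: (ratio_test (N := N) q01) => [k|k Nk]; first by rewrite -ler0c -Uv.
have [Ck qk] := ratio k Nk.
have dk : 0 < k%:R - C by rewrite subr_gt0.
have natC (m : nat) : m%:R = (m%:R : R)%:C by rewrite rmorph_nat.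
have c_lb : (k%:R - C)%:C <= `|c + k%:R|.
  rewrite rmorphB /= -natC -Cc [c + _]addrC -{1}(normr_nat R[i] k) lerBlDr.
  by rewrite (le_trans _ (ler_normB _ _)) // addrK.
have c_gt0 : 0 < `|c + k%:R| by rewrite (lt_le_trans _ c_lb) // ltcR.
have a_ub (m : nat) : `|a + m%:R| <= (A + m%:R)%:C.
  by rewrite (le_trans (ler_normD _ _)) // normr_nat Aa natC -rmorphD.
(* The bound on U k.+1 / U k, with denominators cleared. *)
have step : `|a + (2 * k)%:R| * `|a + (2 * k).+1%:R| * s
    <= q%:C * (`|c + k%:R| * k.+1%:R).
  apply: (@le_trans _ _ ((A + (2 * k)%:R) * (A + (2 * k)%:R + 1) * t)%:C).
    rewrite !rmorphM /= -st ler_wpM2r // ler_pM //.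
    by rewrite -addrA natr1.
  apply: (@le_trans _ _ (q * ((k%:R - C) * k.+1%:R))%:C); first by rewrite lecR.
  rewrite !rmorphM /= -natC ler_wpM2l ?ler_wpM2r //.
  by rewrite ler0c ltW //; case/andP: q01.
rewrite -lecR rmorphM /= -!Uv.
have -> : U k.+1 = (`|a + (2 * k)%:R| * `|a + (2 * k).+1%:R| * s)
    / (`|c + k%:R| * k.+1%:R) * U k.
  rewrite /U /poch_ratio mulnS !pochhammerS !normrM !normfV !normrM exprS factS.
  rewrite (natrM _ k.+1) !invfM.
  by ring.
by rewrite ler_wpM2r // ler_pdivrMr ?mulr_gt0.
Qed.

Theorem lemma2p1 (R : realType) (n : nat) (a c : R[i]) (x : 'I_n -> R[i])
    (n_ge1 : (1 <= n)%N)
    (c_npole : forall k : nat, c != - k%:R)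
    (x_small : \sum_(i < n) `|x i| < 1 / 4) :
  [/\ cvgn (series (hyp2F1_term (a / 2) ((a + 1) / 2) c (4 * \sum_(i < n) x i))),
      cvg (partial_sum (multi_term a c x) @ totally) &
      hyp2F1 (a / 2) ((a + 1) / 2) c (4 * \sum_(i < n) x i)
      = sum (multi_term a c x : _ -> R[i]^o)].
Proof.
set u := hyp2F1_term _ _ _ _; set t := multi_term a c x.
set s := \sum_(i < n) `|x i| in x_small.
have s_ge0 : 0 <= s by exact: sumr_ge0.
have [v v_cvg Uv] := cvg_series_poch_ratio a c s_ge0 x_small.
have u_le k : `|u k| <= (v k)%:C.
  rewrite -Uv /u hyp2F1_term_double normrM normr_exp_fact.
  by rewrite ler_wpM2l // ler_wpM2r ?invr_ge0 // lerXn2r ?nnegrE // ler_norm_sum.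
have u_cvg : cvgn (series u) by exact: cvg_series_complex v u_le v_cvg.
have t_sums N : \sum_(m <- simplex n N) t m = series u N.
  under eq_bigr do rewrite /t multi_termE.
  rewrite sum_simplex /series /= big_mkord; apply: eq_bigr => k _.
  by rewrite /u hyp2F1_term_double.
have abs_sums N : \sum_(m <- simplex n N) `|t m|
    = series (fun k => (v k)%:C : (R[i] : numFieldType)) N.
  under eq_bigr => m _.
    rewrite /t multi_termE normrM normr_prod.
    under eq_bigr do rewrite normr_exp_fact.
    over.
  rewrite (sum_simplex (fun k => `|poch_ratio a c k|)) /series /= big_mkord.
  by apply: eq_bigr => k _; rewrite Uv.
have t_cvg : partial_sum t @ totally --> limn (series u).
  apply: (cvg_totally_exhaustion t (simplex n)).
  - by move=> N M NM; apply/fsubsetP => m; rewrite !in_simplex => /leq_trans; apply.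
  - move=> B; exists (\max_(m <- B) \sum_(i < n) m i).+1%N.
    apply/fsubsetP => m mB; rewrite in_simplex ltnS.
    exact: (@leq_bigmax_seq _ (enum_fset B) predT
      (fun m' : {ffun 'I_n -> nat} => \sum_(i < n) m' i)%N m mB).
  - rewrite (funext abs_sums); apply: (cvg_series_complex v) => // k.
    by rewrite -Uv ger0_norm // mulr_ge0 ?divr_ge0 ?exprn_ge0.
  - by rewrite (funext t_sums).
split.
- exact: u_cvg.
- by apply/cvg_ex; exists (limn (series u)).
- have := @totally_filter {ffun 'I_n -> nat} => totally_proper.
  exact/esym/(cvg_lim (@norm_hausdorff _ R[i]^o) t_cvg).
Qed.
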